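(* Let $1<q<\infty$. The minimal constant $\bar{c}_{1,\infty}(q)>0$ for which $$\sup_{t>0}\,t\left(\frac{1}{t}\int_t^\infty f(s)^q\,\mathrm{d}s\right)^{\frac{1}{q}}\leq\bar{c}_{1,\infty}(q)\sup_{t>0}\,tf(t)$$ holds for all monotonically decreasing functions $f:(0,\infty)\to[0,\infty)$ is $\bar{c}_{1,\infty}(q)=(q-1)^{-\frac{1}{q}}$.
   Context: Suprema of nonnegative quantities and integrals of nonnegative functions take values in $[0,\infty]$. ''Monotonically decreasing'' means $f(s)\geq f(t)$ whenever $0<s\leq t$ (not necessarily strictly). *)

(* Defs.v *)
From mathcomp Require Import all_boot all_order all_algebra.
From mathcomp Require Import all_classical all_reals all_analysis.

Set Implicit Arguments.
Unset Strict Implicit.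
Unset Printing Implicit Defensive.

Import Order.TTheory GRing.Theory Num.Theory.
Import numFieldNormedType.Exports.

Local Open Scope classical_set_scope.
Local Open Scope ring_scope.

(* A function (0, oo) -> [0, oo) is represented by a total f : R -> R; only its
   values on (0, oo) are constrained, and only these are used below. *)
Definition nonneg_decreasing (R : realType) (f : R -> R) : Prop :=
  (forall t, 0 < t -> 0 <= f t) /\
  (forall s t, 0 < s -> s <= t -> f t <= f s).

Definition sup_tail_mean (R : realType) (q : R) (f : R -> R) : \bar R :=
  ereal_sup [set (t%:E *
      ((t^-1)%:E * \int[@lebesgue_measure R]_(s in `]t, +oo[) (f s `^ q)%:E)
        `^ (q^-1))%E
    | t in `]0, +oo[].

Definition sup_weighted (R : realType) (f : R -> R) : \bar R :=
  ereal_sup [set (t * f t)%:E | t in `]0, +oo[].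

Definition admissible_constants (R : realType) (q : R) : set R :=
  [set c | 0 < c /\
    forall f : R -> R, nonneg_decreasing f ->
      (sup_tail_mean q f <= c%:E * sup_weighted f)%E].

Definition is_minimum (R : realType) (A : set R) (m : R) : Prop :=
  A m /\ lbound A m.

(* Main.v *)
Require Import Defs.
From mathcomp Require Import all_boot all_order all_algebra.
From mathcomp Require Import all_classical all_reals all_analysis.
From mathcomp Require Import measurable_realfun ring.

(** The weak quantity [M := sup t f(t)] is the smallest constant with
    [f s <= M / s] for all [s > 0], so everything reduces to the hyperbola
    [s |-> M / s].  For it the tail integral is explicit,
    [\int_t^oo (M / s)^q ds = M^q t^(1-q) / (q - 1)]
    ([integral_powRN_tail]), and the powers of [t] cancel:
    [t (1/t \int_t^oo (M / s)^q ds)^(1/q) = M (q - 1)^(-1/q)] for every [t]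
    ([tail_mean_hyperbola]).  If [M] is finite, monotonicity of the integral
    ([le_tail_mean]) bounds the left-hand side for [f] by this value; if [M] is
    infinite, there is nothing to prove.  Taking [f s = 1 / s], for which
    [M = 1], turns the bound into an equality, so no smaller constant works. *)

Import Order.TTheory GRing.Theory Num.Theory.
Import numFieldNormedType.Exports.

Local Open Scope classical_set_scope.
Local Open Scope ring_scope.

Lemma powR_cvgy (R : realType) (r : R) : 0 < r ->
  x `^ r @[x --> +oo] --> +oo.
Proof.
move=> r0; apply/cvgryPge => A; near=> x.
have x0 : 0 <= x by near: x; exact: nbhs_pinfty_ge.
have : Num.max 0 A `^ r^-1 <= x.
  by near: x; apply: nbhs_pinfty_ge; rewrite num_real.
move=> /(@ge0_ler_powR R r (ltW r0)); rewrite !nnegrE powR_ge0 => /(_ isT x0).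
rewrite -powRrM mulVf ?gt_eqF// powRr1 ?le_max ?lexx//.
by apply: le_trans; rewrite le_max lexx orbT.
Unshelve. all: by end_near. Qed.

Lemma powRN_cvgy (R : realType) (r : R) : 0 < r ->
  x `^ (- r) @[x --> +oo] --> 0.
Proof.
move=> r0.
rewrite (_ : (fun x => _) = (fun x : R => (x `^ r)^-1)); last first.
  by apply/funext => x /=; rewrite powRN.
apply/(@gtr0_cvgV0 _ _ _ _ (fun x : R => x `^ r)); last exact: powR_cvgy.
by near=> x; apply: powR_gt0; near: x; apply: nbhs_pinfty_gt; rewrite num_real.
Unshelve. all: by end_near. Qed.

(** [s `^ (- q)] has the primitive [- (q - 1)^-1 * s `^ (1 - q)], which vanishes
    at infinity because [1 < q]. *)
Lemma integral_powRN_tail (R : realType) (q t : R) : 1 < q -> 0 < t ->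
  (\int[@lebesgue_measure R]_(s in `]t, +oo[) (s `^ (- q))%:E =
   (t `^ (1 - q) / (q - 1))%:E)%E.
Proof.
move=> q1 t0.
have dF (x : R) : t <= x ->
    is_derive x 1 (fun y => - (q - 1)^-1 *: (y `^ (1 - q))) (x `^ (- q)).
  move=> tx; have x0 : 0 < x := lt_le_trans t0 tx.
  have /(@is_deriveZ _ _ _ _ (- (q - 1)^-1)) dpow := @is_derive1_powR R (1 - q) x x0.
  apply: (is_derive_eq dpow).
  rewrite /GRing.scale/= (_ : 1 - q - 1 = - q); last by ring.
  by field; rewrite subr_eq0 gt_eqF.
have cf (x : R) : t <= x -> {for x, continuous (fun y : R => y `^ (- q))}.
  move=> tx; apply/differentiable_continuous/derivable1_diffP.
  by apply: derivable_powR; rewrite in_itv/= andbT (lt_le_trans t0).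
rewrite integral_itv_obnd_cbnd; last first.
  by apply/measurable_EFinP/measurable_funTS; exact: measurable_powR.
rewrite (@ge0_continuous_FTC2y R _ (fun y => - (q - 1)^-1 *: (y `^ (1 - q))) t 0).
- by rewrite -EFinB sub0r scaleNr opprK /GRing.scale/= mulrC.
- by move=> x _; exact: powR_ge0.
- by apply: continuous_in_subspaceT => x; rewrite inE/= in_itv/= andbT => /cf.
- rewrite -(scaler0 _ (- (q - 1)^-1)); apply: cvgZr.
  rewrite (_ : 1 - q = - (q - 1)); last by ring.
  by apply: powRN_cvgy; rewrite subr_gt0.
- by move=> x /ltW /dF [].
- apply: cvg_at_right_filter.
  by have [/derivable1_diffP/differentiable_continuous] := dF _ (lexx t).
- by move=> x; rewrite in_itv/= andbT => /ltW /dF [_ <-]; rewrite derive1E.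
Qed.

(** Scale invariance makes the value independent of [t]; this is why the
    hyperbola is extremal at every [t] simultaneously. *)
Lemma tail_mean_hyperbola (R : realType) (q M t : R) :
  1 < q -> 0 <= M -> 0 < t ->
  (t%:E * ((t^-1)%:E *
      \int[@lebesgue_measure R]_(s in `]t, +oo[) ((M / s) `^ q)%:E) `^ (q^-1) =
   (M * (q - 1) `^ (- q^-1))%:E)%E.
Proof.
move=> q1 M0 t0; have q0 : 0 < q := lt_trans ltr01 q1.
under eq_integral => s.
  rewrite inE/= in_itv/= andbT => ts; have s0 := ltW (lt_trans t0 ts).
  rewrite powRM ?invr_ge0// -(powR_inv1 s0) -powRrM mulN1r EFinM.
  over.
rewrite ge0_integralZl_EFin//; last 3 first.
- by move=> s _; rewrite lee_fin powR_ge0.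
- by apply/measurable_EFinP/measurable_funTS; exact: measurable_powR.
- exact: powR_ge0.
rewrite integral_powRN_tail// -EFinM; congr EFin.
have -> : t^-1 * (M `^ q * (t `^ (1 - q) / (q - 1))) =
    (M / t) `^ q * (q - 1)^-1.
  rewrite powRM ?invr_ge0 ?(ltW t0)// -(powR_inv1 (ltW t0)) -(powRrM t).
  have -> : -1 * q = -1 + (1 - q) by ring.
  rewrite (@powRD _ t (-1)) ?(gt_eqF t0) ?implybT// powR_inv1 ?(ltW t0)//.
  by rewrite mulrCA !mulrA.
have q10 : 0 <= q - 1 by rewrite subr_ge0 ltW.
have Mt0 : 0 <= M / t by rewrite divr_ge0// ltW.
rewrite powRM ?powR_ge0 ?invr_ge0//.
rewrite -powRrM mulfV ?gt_eqF// powRr1//.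
rewrite -(powR_inv1 q10) -powRrM mulN1r.
by rewrite mulrA [t * _]mulrC divfK ?gt_eqF.
Qed.

(** Only the restriction of [f] to the positive reals is monotone; freezing
    its argument below [t] gives a function that is monotone on the whole line
    and agrees with [f] beyond [t]. *)
Lemma nonneg_decreasing_measurable (R : realType) (f : R -> R) (t : R) :
  nonneg_decreasing f -> 0 < t -> measurable_fun `]t, +oo[ f.
Proof.
move=> [_ fdec] t0.
apply: (@eq_measurable_fun _ _ _ _ _ (fun s => f (Num.max t s))).
  by move=> s; rewrite inE/= in_itv/= andbT => /ltW /max_idPr ->.
apply: nonincreasing_measurable => // x y xy.
by apply: fdec; [rewrite lt_max t0 | rewrite ge_max !le_max lexx xy orbT].
Qed.

Lemma le_tail_mean (R : realType) (q t : R) (f g : R -> R) :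
  0 < q -> 0 < t -> nonneg_decreasing f -> nonneg_decreasing g ->
  (forall s, t < s -> f s <= g s) ->
  (t%:E * ((t^-1)%:E *
     \int[@lebesgue_measure R]_(s in `]t, +oo[) (f s `^ q)%:E) `^ (q^-1) <=
   t%:E * ((t^-1)%:E *
     \int[@lebesgue_measure R]_(s in `]t, +oo[) (g s `^ q)%:E) `^ (q^-1))%E.
Proof.
move=> q0 t0 ndf ndg fg.
have mpow h : nonneg_decreasing h ->
    measurable_fun `]t, +oo[ (fun s => (h s `^ q)%:E).
  move=> ndh; apply/measurable_EFinP.
  apply: (measurableT_comp (measurable_powR _)).
  exact: nonneg_decreasing_measurable.
have mean_ge0 h : (0 <= (t^-1)%:E *
    \int[@lebesgue_measure R]_(s in `]t, +oo[) (h s `^ q)%:E)%E.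
  rewrite mule_ge0 ?lee_fin ?invr_ge0 ?(ltW t0)//.
  by apply: integral_ge0 => s _; rewrite lee_fin powR_ge0.
apply: lee_wpmul2l; first by rewrite lee_fin ltW.
apply: gt0_ler_poweR; rewrite ?in_itv/= ?leey ?andbT ?invr_ge0 ?(ltW q0)//.
apply: lee_wpmul2l; first by rewrite lee_fin invr_ge0 ltW.
apply: ge0_le_integral; [by []| |exact: mpow|exact: mpow|].
  by move=> s _; rewrite lee_fin powR_ge0.
move=> s /=; rewrite in_itv/= andbT => ts.
have s0 := lt_trans t0 ts.
by rewrite lee_fin ge0_ler_powR ?nnegrE ?(ltW q0) ?fg// (ndf.1, ndg.1).
Qed.

Lemma nonneg_decreasing_hyperbola (R : realType) (M : R) :
  0 <= M -> nonneg_decreasing (fun s => M / s).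
Proof.
move=> M0; split=> [t t0|s t s0 st]; first by rewrite divr_ge0// ltW.
by rewrite ler_wpM2l// lef_pV2// posrE// (lt_le_trans s0).
Qed.

Theorem theorem4p3 (R : realType) (q : R) (hq : 1 < q) :
  is_minimum (admissible_constants q) ((q - 1) `^ (- q^-1)).
Proof.
have q0 : 0 < q := lt_trans ltr01 hq.
have K0 : 0 < (q - 1) `^ (- q^-1) by rewrite powR_gt0 ?subr_gt0.
split.
  split=> // f ndf.
  have le_sup t : 0 < t -> ((t * f t)%:E <= sup_weighted f)%E.
    by move=> t0; apply: ereal_sup_ubound; exists t; rewrite //= in_itv/= t0.
  (* The value -oo is excluded by the point t = 1 of the supremum. *)
  case: (sup_weighted f) le_sup => [M|_|/(_ 1 ltr01)]; last by [].
  - move=> le_sup.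
    have M0 : 0 <= M.
      rewrite -lee_fin (le_trans _ (le_sup _ ltr01))// lee_fin mul1r.
      exact: ndf.1.
    apply: ge_ereal_sup => _ [t + <-]; rewrite /= in_itv/= andbT => t0.
    rewrite -EFinM mulrC -(tail_mean_hyperbola _ _ _ _ hq M0 t0).
    apply: le_tail_mean => //; first exact: nonneg_decreasing_hyperbola.
    move=> s ts; have s0 := lt_trans t0 ts.
    by rewrite ler_pdivlMr// mulrC -lee_fin le_sup.
  - by rewrite gt0_muley ?leey ?lte_fin.
move=> c [c0 hc].
have nd1 := nonneg_decreasing_hyperbola _ _ (@ler01 R).
have w1 : (sup_weighted (fun s : R => (1 / s)%R) <= 1)%E.
  apply: ge_ereal_sup => _ [t + <-]; rewrite /= in_itv/= andbT => t0.
  by rewrite div1r mulfV ?gt_eqF.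
rewrite -lee_fin -[c%:E]mule1.
apply: le_trans (lee_wpmul2l _ w1); last by rewrite lee_fin ltW.
apply: le_trans (hc _ nd1).
(* The tail mean of 1 / s does not depend on t, so t = 1 serves. *)
rewrite -[X in (X%:E <= _)%E]mul1r -(tail_mean_hyperbola _ _ _ _ hq ler01 ltr01).
by apply: ereal_sup_ubound; exists 1; rewrite //= in_itv/= ltr01.
Qed.
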